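(* Let $M$ be a smooth manifold with a $C^0$ semi-Riemannian metric $g$ and let $F$ be a $(0,2)$-tensor field on $M$ of regularity $C^0$. Then $$F(\mathbf{v},\mathbf{v})\ge 0\quad\text{for all null vectors } \mathbf{v}\in TM$$ if and only if for each compact subset $Z\subseteq M$ there is a constant $C^T_Z\in\mathbb{R}$ such that $$F(\mathbf{v},\mathbf{v})\ \ge\ C^T_Z\cdot g(\mathbf{v},\mathbf{v})\qquad\text{for all timelike } \mathbf{v}\in TM|_Z .$$ Moreover, if $F(\mathbf v,\mathbf v)\ge 0$ for all null vectors, one may take $C_Z^T=-C_Z$, where $C_Z\in\mathbb{R}$ is any constant with $F(\mathbf{v},\mathbf{v})\ge C_Z\,|g(\mathbf{v},\mathbf{v})|$ for all $\mathbf{v}\in TM|_Z$ (such a constant exists).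
   Context: A $C^0$ semi-Riemannian metric is a continuous symmetric $(0,2)$-tensor field that is non-degenerate at each point with constant signature. The sign convention is that Lorentzian metrics have signature $(-,+,\dots,+)$: a vector $\mathbf{v}\in TM$ is null if $g(\mathbf{v},\mathbf{v})=0$ and timelike if $g(\mathbf{v},\mathbf{v})<0$. $TM|_Z$ denotes the set of all tangent vectors of $M$ with base point in $Z$. *)

(* Defs.v *)
From HB Require Import structures.
From mathcomp Require Import all_boot all_order all_algebra.
From mathcomp Require Import sesquilinear.
From mathcomp Require Import all_classical all_reals all_analysis.

Set Implicit Arguments.
Unset Strict Implicit.
Unset Printing Implicit Defensive.

Import Order.TTheory GRing.Theory Num.Theory.
Import numFieldNormedType.Exports.

Local Open Scope classical_set_scope.
Local Open Scope ring_scope.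

Section Smooth.
Context {R : realType} {V W : normedModType R}.

(* Meant for open [U]: the interior values of [f] are then all that matters. *)
Fixpoint Ck_on (k : nat) (U : set V) (f : V -> W) : Prop :=
  if k is k'.+1 then
    (forall x, U x -> differentiable f x) /\
    (forall v, Ck_on k' U (fun x => 'd f x v))
  else forall x, U x -> {for x, continuous f}.

Definition smooth_on (U : set V) (f : V -> W) : Prop := forall k, Ck_on k U f.

End Smooth.

(* A smooth manifold of dimension [n], without boundary, given by a smooth
   atlas. [chart i] and [chartV i] are total functions; only the values of
   [chart i] on [chart_dom i] and of [chartV i] on the image of [chart_dom i] matter. *)
Record smoothManifold (R : realType) (n : nat) := SmoothManifold {
  carrier :> topologicalType;
  manifold_hausdorff : hausdorff_space carrier;
  manifold_second_countable : @second_countable carrier;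
  chart_index : Type;
  chart_dom : chart_index -> set carrier;
  chart : chart_index -> carrier -> 'rV[R]_n;
  chartV : chart_index -> 'rV[R]_n -> carrier;
  chart_dom_open : forall i, open (chart_dom i);
  chart_image_open : forall i, open (chart i @` chart_dom i);
  chartK : forall i p, chart_dom i p -> chartV i (chart i p) = p;
  chart_continuous : forall i p, chart_dom i p -> {for p, continuous (chart i)};
  chartV_continuous : forall i x, (chart i @` chart_dom i) x ->
    {for x, continuous (chartV i)};
  chart_dom_cover : forall p, exists i, chart_dom i p;
  transition_smooth : forall i j,
    smooth_on (chart i @` (chart_dom i `&` chart_dom j)) (chart j \o chartV i)
}.

Section Tangent.
Context {R : realType} {n : nat} (M : smoothManifold R n).

Definition transition (i j : chart_index M) : 'rV[R]_n -> 'rV[R]_n :=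
  chart (s := M) j \o chartV i.

(* A tangent vector at [p] is the family of its components in the charts around
   [p], related by the differentials of the transition maps. Components in
   charts whose domain misses [p] are set to [0], so that distinct families are
   distinct vectors. *)
Definition is_tangent (p : M) (v : chart_index M -> 'rV[R]_n) : Prop :=
  (forall i, ~ chart_dom i p -> v i = 0) /\
  (forall i j, chart_dom i p -> chart_dom j p ->
     v j = 'd (transition i j) (chart i p) (v i)).

Definition tangent_pred (p : M) : {pred chart_index M -> 'rV[R]_n} :=
  fun v => `[< is_tangent p v >].

Lemma tangent_submod (p : M) : submod_closed (tangent_pred p).
Proof.
split=> [|a u v /asboolP[u0 ud] /asboolP[v0 vd]]; apply/asboolP.
  by split=> // i j _ _; rewrite [RHS](linear0 ('d (transition i j) _)).
have E i : (a *: u + v) i = a *: u i + v i by [].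
split=> [i ip|i j ip jp]; first by rewrite E u0// v0// scaler0 addr0.
by rewrite !E linearP -ud// -vd.
Qed.

HB.instance Definition _ p :=
  GRing.isSubmodClosed.Build R _ (tangent_pred p) (tangent_submod p).

Record tangent (p : M) := Tangent {
  component : chart_index M -> 'rV[R]_n;
  component_tangent : component \in tangent_pred p
}.

HB.instance Definition _ p := [isSub for @component p].
HB.instance Definition _ p := [Choice of tangent p by <:].
HB.instance Definition _ p := [SubChoice_isSubLmodule of tangent p by <:].

Definition tensor02 : Type := forall p : M, {biscalar (tangent p)}.

(* In each chart, [F] has a coefficient matrix depending continuously on the
   point. *)
Definition continuous_tensor02 (F : tensor02) : Prop :=
  forall i, exists A : M -> 'M[R]_n,
    (forall p, chart_dom i p -> {for p, continuous A}) /\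
    (forall p, chart_dom i p -> forall v w : tangent p,
       F p v w = (component v i *m A p *m (component w i)^T) 0 0).

Definition is_basis (p : M) (e : 'I_n -> tangent p) : Prop :=
  forall v, exists! c : 'rV[R]_n, v = \sum_k c 0 k *: e k.

(* Sylvester normal form: [q] times -1, then [n - q] times 1. *)
Definition has_signature (q : 'I_n.+1) (p : M) (b : {biscalar (tangent p)}) :
    Prop :=
  exists2 e : 'I_n -> tangent p, is_basis e &
    forall k l, b (e k) (e l) =
      if k == l then (if (k < q)%N then -1 else 1) else 0.

Record semi_riemannian (g : tensor02) : Prop := SemiRiemannian {
  metric_continuous : continuous_tensor02 g;
  metric_sym : forall p (v w : tangent p), g p v w = g p w v;
  metric_nondegenerate : forall p (v : tangent p),
    (forall w, g p v w = 0) -> v = 0;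
  metric_signature : exists q, forall p, has_signature q (g p)
}.

Definition is_null (g : tensor02) (p : M) (v : tangent p) : Prop := g p v v = 0.

Definition is_timelike (g : tensor02) (p : M) (v : tangent p) : Prop :=
  g p v v < 0.

End Tangent.

(* Main.v *)
(** On a plane containing both a timelike and a spacelike vector, the null cone
    of [g] consists of two lines, and nonnegativity of [F] on them forces
    [F(u,u)/g(u,u) <= F(w,w)/g(w,w)] whenever [g(u,u) < 0 < g(w,w)]. So near a
    point where [g] is indefinite, comparison with two vectors having fixed
    components in a chart bounds [F/|g|] from below locally uniformly; near a
    point where [g] is definite, [|g|] dominates a positive definite form with
    fixed coefficients. Compactness makes the bound uniform. Conversely, a null
    vector is a limit of timelike vectors with the same base point. *)
Require Import Defs.
From mathcomp Require Import all_boot all_order all_algebra.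
From mathcomp Require Import sesquilinear.
From mathcomp Require Import all_classical all_reals all_analysis.
From mathcomp Require Import ring lra.

Set Implicit Arguments.
Unset Strict Implicit.
Unset Printing Implicit Defensive.

Import Order.TTheory GRing.Theory Num.Theory.
Import numFieldNormedType.Exports.

Local Open Scope classical_set_scope.
Local Open Scope ring_scope.

(** * Inequalities for two bilinear forms on one vector space *)

Section Biscalar.
Context {R : comNzRingType} {U : lmodType R} (b : {biscalar U}).

Lemma biscalar_comb (s t : R) (u w : U) :
  b (s *: u + t *: w) (s *: u + t *: w) =
  s ^+ 2 * b u u + s * t * (b u w + b w u) + t ^+ 2 * b w w.
Proof.
rewrite linearDl !linearDr !linearZl_LR !linearZr_LR /=; ring.
Qed.

Lemma biscalar_sum n (c d : 'I_n -> R) (e f : 'I_n -> U) :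
  b (\sum_k c k *: e k) (\sum_l d l *: f l) =
  \sum_k \sum_l c k * d l * b (e k) (f l).
Proof.
rewrite linear_sumlz; apply: eq_bigr => k _.
rewrite /= linear_sumr; apply: eq_bigr => l _.
by rewrite linearZl_LR linearZr_LR /= mulrA.
Qed.

End Biscalar.

(* The vector [u + t w] is null for one negative and one positive value of [t];
   a positive combination of the values of [f] there cancels the mixed terms. *)
Lemma nonneg_on_null_cross (R : rcfType) (U : lmodType R)
    (g f : {biscalar U}) (u w : U) :
  (forall v, g v v = 0 -> 0 <= f v v) -> g u u < 0 -> 0 < g w w ->
  0 <= f u u * g w w - g u u * f w w.
Proof.
move=> fnull gu gw; set a := g w w; set c := g u u.
pose B := g u w + g w u; pose d := Num.sqrt (B ^+ 2 - 4 * a * c).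
have disc_gt : B ^+ 2 < B ^+ 2 - 4 * a * c by rewrite /a /c; nra.
have dE : d ^+ 2 = B ^+ 2 - 4 * a * c.
  by rewrite sqr_sqrtr// (le_trans (sqr_ge0 B))// ltW.
have d_gt0 : 0 < d by rewrite sqrtr_gt0 (le_lt_trans (sqr_ge0 B)).
have Bd1 : - d < B by nra.
have Bd2 : B < d by nra.
(* The roots of [a t^2 + B t + c] are [t = (s - B) / (2 * a)] with [s] equal to [d] or [- d];
   scaling [u + t w] by [2 * a] clears the denominator. *)
have root (s : R) : s ^+ 2 = d ^+ 2 ->
    0 <= (2 * a) ^+ 2 * f u u + (2 * a) * (s - B) * (f u w + f w u) +
      (s - B) ^+ 2 * f w w.
  move=> sE; rewrite -biscalar_comb; apply: fnull.
  rewrite biscalar_comb -/a -/c -/B.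
  have -> : (2 * a) ^+ 2 * c + 2 * a * (s - B) * B + (s - B) ^+ 2 * a =
    a * (s ^+ 2 - (B ^+ 2 - 4 * a * c)) by ring.
  by rewrite sE dE subrr mulr0.
have := root d erefl; have := root (- d) (sqrrN d).
set S := f u w + f w u => r1 r2.
have h1 : 0 <= d - B by lra.
have h2 : 0 <= d + B by lra.
(* Weight [d - B] on the root [- d] and [d + B] on the root [d] give [S] the coefficient zero. *)
have := addr_ge0 (mulr_ge0 h1 r1) (mulr_ge0 h2 r2).
have -> : (d - B) * ((2 * a) ^+ 2 * f u u + 2 * a * (- d - B) * S +
      (- d - B) ^+ 2 * f w w) +
    (d + B) * ((2 * a) ^+ 2 * f u u + 2 * a * (d - B) * S +
      (d - B) ^+ 2 * f w w) =
    2 * d * ((2 * a) ^+ 2 * f u u + (d ^+ 2 - B ^+ 2) * f w w) by ring.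
rewrite dE (_ : _ + _ = 4 * a * (f u u * a - c * f w w)); last by ring.
by rewrite pmulr_rge0 ?pmulr_rge0 ?mulr_gt0.
Qed.

Lemma small_quadratic (R : realFieldType) (a x y : R) : 0 < a ->
  exists2 t0, 0 < t0 & forall t, 0 < t <= t0 -> t * x + t ^+ 2 * y < a.
Proof.
(* Since [a <= K], the choice [t <= a / (2 * K)] forces [t <= 1], so the expression is at most
   [t * K <= a / 2]. *)
move=> a0; pose K := `|x| + `|y| + a.
have K0 : 0 < K by rewrite ltr_wpDl ?addr_ge0.
exists (a / (2 * K)); first by rewrite divr_gt0 ?mulr_gt0.
move=> t /andP[t0]; rewrite ler_pdivlMr ?mulr_gt0// => tK.
have nx := ler_norm x; have ny := ler_norm y.
have px := normr_ge0 x; have py := normr_ge0 y.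
have aK : a <= K by rewrite /K lerDr addr_ge0.
have t1 : t <= 1 by nra.
have -> : t * x + t ^+ 2 * y = t * (x + t * y) by ring.
have : t * y <= `|y| by nra.
move=> ty; have : t * (x + t * y) <= t * K by rewrite ler_pM2l// /K; lra.
lra.
Qed.

(* A null vector [v] is the limit of timelike vectors [v + t w], where
   [g v w <> 0] and [t] has the sign opposite to [g v w]. *)
Lemma nonneg_on_null_of_timelike (R : realFieldType) (U : lmodType R)
    (g f : {biscalar U}) (C : R) :
  (forall v w, g v w = g w v) -> (forall v, (forall w, g v w = 0) -> v = 0) ->
  (forall v, g v v < 0 -> C * g v v <= f v v) ->
  forall v, g v v = 0 -> 0 <= f v v.
Proof.
move=> gsym gnd hC v gv0.
have [[w gvw]|h] := pselect (exists w, g v w != 0); last first.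
  have -> : v = 0.
    apply: gnd => w; apply/eqP/negPn/negP => gvw; by apply: h; exists w.
  by rewrite linear0l.
wlog gvw_lt0 : w gvw / g v w < 0.
  move=> hw; have [gvw0|gvw0|/eqP] := ltgtP (g v w) 0; first exact: (hw w).
  - by apply: (hw (- w)); rewrite linearNr ?oppr_eq0 ?oppr_lt0.
  - by rewrite (negPf gvw).
rewrite leNgt; apply/negP => fv_lt0.
(* Below [t1] the vector [v + t w] is timelike; below [t2] the form [f - C g] is negative on it,
   which contradicts [hC]. *)
have [t1 t1_gt0 ht1] := small_quadratic (g w w) 0
  (ltac:(lra) : 0 < - (2 * g v w)).
have [t2 t2_gt0 ht2] := small_quadratic
  (f v w + f w v - C * (2 * g v w)) (f w w - C * g w w)
  (ltac:(lra) : 0 < - f v v).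
pose t := Num.min t1 t2.
have t0 : 0 < t by rewrite lt_min t1_gt0.
have := ht1 t; rewrite t0 ge_min lexx => /(_ isT) tg.
have := ht2 t; rewrite t0 ge_min lexx orbT => /(_ isT) tf.
have gE : g (1 *: v + t *: w) (1 *: v + t *: w) = t * (2 * g v w + t * g w w).
  by rewrite biscalar_comb gv0 (gsym w v); ring.
have gneg : g (1 *: v + t *: w) (1 *: v + t *: w) < 0.
  by rewrite gE pmulr_rlt0//; lra.
have := hC _ gneg; rewrite gE biscalar_comb; lra.
Qed.

Lemma cvg_sum_pointwise (R : realType) (T : Type) (H : set_system T) (I : Type)
    (r : seq I) (f : I -> T -> R) (l : I -> R) : Filter H ->
  (forall i, f i @ H --> l i) ->
  (fun x => \sum_(i <- r) f i x) @ H --> \sum_(i <- r) l i.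
Proof.
move=> FH fl; elim: r => [|i r IH].
  rewrite big_nil [X in X @ _](_ : _ = fun=> 0); first exact: cvg_cst.
  by apply/funext => x; rewrite big_nil.
rewrite big_cons [X in X @ _](_ : _ = f i \+ fun x => \sum_(j <- r) f j x).
  exact: cvgD.
by apply/funext => x; rewrite big_cons.
Qed.

(** Termwise [|c k * c l| <= (c k ^+ 2 + c l ^+ 2) / 2]; each square is then counted [n] times. *)
Lemma ler_norm_bilinear_sum (R : realFieldType) n (D : 'I_n -> 'I_n -> R)
    (c : 'I_n -> R) (K : R) : (forall k l, `|D k l| <= K) ->
  `|\sum_k \sum_l c k * c l * D k l| <= K * n%:R * \sum_k c k ^+ 2.
Proof.
move=> DK; have K0 k : 0 <= K := le_trans (normr_ge0 _) (DK k k).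
have -> : K * n%:R * \sum_k c k ^+ 2 =
    \sum_k \sum_l K * ((c k ^+ 2 + c l ^+ 2) / 2).
  have inner k : \sum_(l < n) K * ((c k ^+ 2 + c l ^+ 2) / 2) =
      K / 2 * (n%:R * c k ^+ 2 + \sum_l c l ^+ 2).
    rewrite -mulr_sumr -mulr_suml big_split/= sumr_const card_ord -mulr_natl.
    by ring.
  under [RHS]eq_bigr do rewrite inner.
  rewrite -mulr_sumr big_split/= sumr_const card_ord -mulr_sumr -mulr_natl.
  by field.
apply: le_trans (ler_norm_sum _ _ _) _; apply: ler_sum => k _.
apply: le_trans (ler_norm_sum _ _ _) _; apply: ler_sum => l _.
rewrite !normrM mulrC ler_pM ?mulr_ge0//.
rewrite -(real_normK (num_real (c k))) -(real_normK (num_real (c l))).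
have := sqr_ge0 (`|c k| - `|c l|); clear K0; lra.
Qed.

(** A timelike [v] is compared with [w] and a spacelike one with [u] through [nonneg_on_null_cross];
    the factor 2 is the inverse of the lower bound on [|g|] at the comparison vector. *)
Lemma lower_bound_indefinite (R : rcfType) (U : lmodType R)
    (g f : {biscalar U}) (u w : U) (P : R) :
  (forall v, g v v = 0 -> 0 <= f v v) -> 0 <= P ->
  g u u <= - 2^-1 -> 2^-1 <= g w w -> f u u <= P -> f w w <= P ->
  forall v, - (2 * P) * `|g v v| <= f v v.
Proof.
move=> fnull P0 gu gw fu fw v.
(* Here [a], [x] stand for [|g|], [f] at [v], and [b], [y] for the same at the comparison vector. If
   [x < 0], then [x / 2 >= x * b >= - a * P]. *)
have cross (a b x y : R) : 0 < a -> 2^-1 <= b -> y <= P ->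
    0 <= x * b + a * y -> - (2 * P) * a <= x.
  move=> a0 b0 yP xy.
  have ay : a * y <= a * P by rewrite ler_pM2l.
  rewrite leNgt; apply/negP => x1.
  have x0 : x < 0 by apply: (lt_le_trans x1); nra.
  nra.
have [gv|gv|gv] := ltgtP (g v v) 0.
- have h := nonneg_on_null_cross fnull gv (ltac:(lra) : 0 < g w w).
  by rewrite (ltr0_norm gv); apply: (cross _ (g w w) _ (f w w)); lra.
- have h := nonneg_on_null_cross fnull (ltac:(lra) : g u u < 0) gv.
  by rewrite (gtr0_norm gv); apply: (cross _ (- g u u) _ (f u u)); lra.
- by rewrite gv normr0 mulr0 fnull.
Qed.

(** With [S] the sum of squared coefficients, [g v v] differs from [sg * S] by at most [S / 2], so
    [S <= 2 * |g v v|], while [|f v v| <= P * n * S]. *)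
Lemma lower_bound_definite (R : realFieldType) (U : lmodType R)
    (g f : {biscalar U}) n (e : 'I_n -> U) (sg eps P : R) :
  `|sg| = 1 -> eps * n%:R <= 2^-1 -> 0 <= P ->
  (forall k l, `|g (e k) (e l) - sg * (k == l)%:R| <= eps) ->
  (forall k l, `|f (e k) (e l)| <= P) ->
  forall (c : 'I_n -> R) v, v = \sum_k c k *: e k ->
    - (2 * P * n%:R) * `|g v v| <= f v v.
Proof.
move=> sg1 epsn P0 ge fe c v vE; set S := \sum_k c k ^+ 2.
have S0 : 0 <= S by apply: sumr_ge0 => k _; exact: sqr_ge0.
have fS := ler_norm_bilinear_sum c fe; rewrite -biscalar_sum -vE -/S in fS.
have gS := ler_norm_bilinear_sum c ge; rewrite -/S in gS.
have gSE : \sum_k \sum_l c k * c l * (g (e k) (e l) - sg * (k == l)%:R) =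
    g v v - sg * S.
  rewrite vE biscalar_sum /S mulr_sumr -sumrB; apply: eq_bigr => k _.
  under eq_bigr do rewrite mulrBr.
  rewrite sumrB; congr (_ - _); rewrite (bigD1 k)//= big1 => [|l lk].
    by rewrite eqxx mulr1; ring.
  by rewrite eq_sym (negPf lk) !mulr0.
rewrite gSE in gS.
have SG : S <= 2 * `|g v v|.
  have : `|sg * S| <= `|g v v| + `|g v v - sg * S|.
    rewrite [X in `|X| <= _](_ : _ = g v v - (g v v - sg * S)); last by ring.
    exact: ler_normB.
  rewrite normrM sg1 mul1r (ger0_norm S0).
  have : eps * n%:R * S <= 2^-1 * S by rewrite ler_wpM2r.
  lra.
move: fS; rewrite ler_norml => /andP[fS _]; apply: le_trans fS.
rewrite mulNr lerN2.
have : P * n%:R * S <= P * n%:R * (2 * `|g v v|) by rewrite ler_wpM2l// mulr_ge0.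
lra.
Qed.

(** * Frames in a chart and the bound near a point *)

Section Frames.
Context {R : realType} {n : nat} {M : smoothManifold R n}.
Implicit Types (p q : M) (i : chart_index M).

Lemma component_sum i p m (c : 'I_m -> R) (e : 'I_m -> tangent p) :
  component (\sum_k c k *: e k) i = \sum_k c k *: component (e k) i.
Proof. exact: (big_morph (fun v : tangent p => component v i)). Qed.

Lemma component_inj i p : chart_dom i p ->
  injective (fun v : tangent p => component v i).
Proof.
move=> ip v w vw; apply: val_inj => /=; apply/funext => j.
have /asboolP[v0 vd] := component_tangent v.
have /asboolP[w0 wd] := component_tangent w.
have [jp|jp] := pselect (chart_dom j p); last by rewrite v0// w0.
by rewrite (vd i)// (wd i)// vw.
Qed.

(* The components of a basis form an invertible matrix because [component_inj]
   makes its rows free. *)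
Lemma basis_components i p (e : 'I_n -> tangent p) : chart_dom i p ->
  is_basis e -> (\matrix_k component (e k) i) \in unitmx.
Proof.
move=> ip eb; set E := \matrix_k _.
rewrite -row_free_unit; apply: inj_row_free => c cE.
have cE' : component (\sum_k c 0 k *: e k) i = 0.
  rewrite component_sum -[RHS]cE mulmx_sum_row.
  by apply: eq_bigr => k _; rewrite rowK.
have c0 : 0 = \sum_k c 0 k *: e k by apply: (component_inj ip).
have [d [_ du]] := eb 0.
rewrite -(du _ c0) (du 0)//.
by rewrite big1// => k _; rewrite mxE scale0r.
Qed.

(** The vector is a combination of basis vectors, hence automatically compatible with all transition
    maps; its coefficients come from the inverse of the component matrix. *)
Lemma component_surj i p (e : 'I_n -> tangent p) (x : 'rV[R]_n) :
  chart_dom i p -> is_basis e -> exists v : tangent p, component v i = x.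
Proof.
move=> ip eb; have Eu := basis_components ip eb.
set E := \matrix_k _ in Eu.
set y := x *m invmx E; exists (\sum_k y 0 k *: e k).
rewrite component_sum -[RHS](mulmxKV Eu) -/y mulmx_sum_row.
by apply: eq_bigr => k _; rewrite rowK.
Qed.

(** Keeping the components in one chart keeps their matrix, whose invertibility makes the new frame
    generate. The basis [f] serves to realise these components at [q]. *)
Lemma frame_transport i p q (e : 'I_n -> tangent p) (f : 'I_n -> tangent q) :
  chart_dom i p -> chart_dom i q -> is_basis e -> is_basis f ->
  exists e' : 'I_n -> tangent q,
    (forall k, component (e' k) i = component (e k) i) /\
    forall v, exists c : 'I_n -> R, v = \sum_k c k *: e' k.
Proof.
move=> ip iq eb fb; have Eu := basis_components ip eb.
set E := \matrix_k _ in Eu.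
have /choice[e' e'E] k := component_surj (component (e k) i) iq fb.
exists e'; split => // v; set y := component v i *m invmx E.
exists (fun k => y 0 k); apply: (component_inj iq).
rewrite component_sum -[LHS](mulmxKV Eu) -/y mulmx_sum_row.
by apply: eq_bigr => k _; rewrite rowK e'E.
Qed.

(** With the components frozen, the value of [F] is a finite sum linear in the entries of a
    continuous matrix. *)
Lemma tensor02_near (F : tensor02 M) i p (v w : tangent p) (eps : R) :
  continuous_tensor02 F -> chart_dom i p -> 0 < eps ->
  \forall q \near p, chart_dom i q /\ forall v' w' : tangent q,
    component v' i = component v i -> component w' i = component w i ->
    `|F q v' w' - F p v w| < eps.
Proof.
move=> /(_ i)[A [Ac AF]] ip eps0.
set x := component v i; set y := component w i.
have Fc : (fun q => \sum_l (\sum_k x 0 k * A q k l) * y 0 l) @ p -->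
    \sum_l (\sum_k x 0 k * A p k l) * y 0 l.
  apply: cvg_sum_pointwise => l; apply: cvgM; last exact: cvg_cst.
  apply: cvg_sum_pointwise => k; apply: cvgM; first exact: cvg_cst.
  exact: cvg_comp (Ac p ip) (@coord_continuous _ _ _ k l (A p)).
have FE q (v' w' : tangent q) : chart_dom i q ->
    component v' i = x -> component w' i = y ->
    F q v' w' = \sum_l (\sum_k x 0 k * A q k l) * y 0 l.
  move=> iq vx wy; rewrite AF// vx wy mxE.
  by apply: eq_bigr => l _; rewrite !mxE.
have inear : \forall q \near p, chart_dom i q.
  by apply: open_nbhs_nbhs; split => //; exact: chart_dom_open.
near=> q; have iq : chart_dom i q by near: q.
split=> // v' w' vx wy; rewrite distrC (FE q)// (FE p)//.
by near: q; exact: cvgr_dist_lt.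
Unshelve. all: by end_near. Qed.

Lemma local_bound (g F : tensor02 M) p :
  semi_riemannian g -> continuous_tensor02 F ->
  (forall q (v : tangent q), is_null g v -> 0 <= F q v v) ->
  exists K : R, \forall q \near p,
    forall v : tangent q, - K * `|g q v v| <= F q v v.
Proof.
move=> hg hF Fnull; have [s gsig] := metric_signature hg.
have [i ip] := chart_dom_cover p.
have [e eb ge] := gsig p.
pose Fmax := \sum_k \sum_l `|F p (e k) (e l)|.
have Fmax0 : 0 <= Fmax by apply: sumr_ge0 => k _; apply: sumr_ge0.
have FleFmax k l : `|F p (e k) (e l)| <= Fmax.
  rewrite /Fmax (bigD1 k)//= (bigD1 l)//= -addrA lerDl.
  by rewrite addr_ge0 ?sumr_ge0// => *; rewrite sumr_ge0.
(* Both [eps <= 1 / 2] and [eps * n <= 1 / 2] follow, for the indefinite and the definite case;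
   [n.+1] keeps the denominator nonzero when [n = 0]. *)
pose eps : R := (2 * n.+1%:R)^-1.
have eps0 : 0 < eps by rewrite invr_gt0 mulr_gt0.
have epsn : eps * n.+1%:R = 2^-1.
  by rewrite /eps invfM -mulrA mulVf ?mulr1 ?pnatr_eq0.
exists (2 * (Fmax + 1) * n.+1%:R).
have gnear : \forall q \near p, forall k l, chart_dom i q /\
    forall v w : tangent q, component v i = component (e k) i ->
    component w i = component (e l) i ->
    `|g q v w - g p (e k) (e l)| < eps.
  apply: filter_forall => k; apply: filter_forall => l.
  exact: tensor02_near (metric_continuous hg) ip eps0.
have Fnear : \forall q \near p, forall k l, chart_dom i q /\
    forall v w : tangent q, component v i = component (e k) i ->
    component w i = component (e l) i ->
    `|F q v w - F p (e k) (e l)| < 1.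
  apply: filter_forall => k; apply: filter_forall => l.
  exact: tensor02_near hF ip ltr01.
have inear : \forall q \near p, chart_dom i q.
  by apply: open_nbhs_nbhs; split => //; exact: chart_dom_open.
apply: filterS3 inear gnear Fnear => q iq gq Fq v.
have [f fb _] := gsig q.
have [e' [e'E e'gen]] := frame_transport ip iq eb fb.
have {}gq k l : `|g q (e' k) (e' l) - g p (e k) (e l)| <= eps.
  by have [_ h] := gq k l; rewrite ltW ?h.
have {}Fq k l : `|F q (e' k) (e' l)| <= Fmax + 1.
  rewrite -[F q _ _](subrK (F p (e k) (e l))) (le_trans (ler_normD _ _))//.
  have [_ h] := Fq k l; rewrite addrC lerD ?FleFmax// ltW ?h//.
have P0 : 0 <= Fmax + 1 by rewrite addr_ge0.
(* The indefinite case yields [m = 1] and the definite case [m = n]. *)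
have weaken m : (m <= n.+1)%N -> - (2 * (Fmax + 1) * m%:R) * `|g q v v| <= F q v v ->
    - (2 * (Fmax + 1) * n.+1%:R) * `|g q v v| <= F q v v.
  move=> mn; apply: le_trans; rewrite ler_wpM2r// lerN2 ler_wpM2l ?mulr_ge0//.
  by rewrite ler_nat.
have [[k [l [ks ls]]]|nind] :=
  pselect (exists k l : 'I_n, (k < s)%N /\ ~~ (l < s)%N).
  have := gq k k; have := gq l l; rewrite !ge !eqxx ks (negPf ls) !ler_norml.
  have eps12 : eps <= 2^-1 by rewrite -epsn ler_peMr ?ler1n// ltW.
  move=> /andP[gl _] /andP[_ gk].
  apply: (weaken 1) => //; rewrite mulr1.
  apply: (@lower_bound_indefinite _ _ _ _ (e' k) (e' l)) => //.
  - exact: Fnull.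
  - by lra.
  - by lra.
  - exact: le_trans (ler_norm _) (Fq k k).
  - exact: le_trans (ler_norm _) (Fq l l).
(* Without both signs in the normal form at [p], all diagonal entries equal a common [sg]. *)
have [sg sg1 gpe] : exists2 sg : R, `|sg| = 1 &
    forall k l, g p (e k) (e l) = sg * (k == l)%:R.
  have [[k0 k0s]|nk] := pselect (exists k : 'I_n, (k < s)%N).
    exists (-1) => [|k l]; first by rewrite normrN1.
    rewrite ge; case: eqVneq => _; rewrite ?mulr0// mulr1.
    by case: ifPn => // ks; exfalso; apply: nind; exists k0, k.
  exists 1 => [|k l]; first by rewrite normr1.
  rewrite ge; case: eqVneq => _; rewrite ?mulr0// mulr1.
  by case: ifPn => // ks; exfalso; apply: nk; exists k.
apply: (weaken n) => //; have [c vE] := e'gen v.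
apply: (@lower_bound_definite _ _ _ _ _ e' sg eps _ _ _ _ _ _ c) => //.
- by rewrite -epsn ler_pM2l// ler_nat.
- by move=> k l; rewrite -gpe.
Qed.

End Frames.

(** * From local bounds to compact sets, and the equivalence *)

Theorem corollary2p2 (R : realType) (n : nat) (M : smoothManifold R n)
    (g F : tensor02 M) (hg : semi_riemannian g) (hF : continuous_tensor02 F) :
  ((forall (p : M) (v : tangent p), is_null g v -> 0 <= F p v v) <->
   (forall Z : set M, compact Z ->
      exists CT : R, forall (p : M) (v : tangent p),
        Z p -> is_timelike g v -> CT * g p v v <= F p v v)) /\
  ((forall (p : M) (v : tangent p), is_null g v -> 0 <= F p v v) ->
   forall Z : set M, compact Z ->
     (exists C : R, forall (p : M) (v : tangent p),
        Z p -> C * `|g p v v| <= F p v v) /\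
     (forall C : R,
        (forall (p : M) (v : tangent p), Z p -> C * `|g p v v| <= F p v v) ->
        forall (p : M) (v : tangent p),
          Z p -> is_timelike g v -> - C * g p v v <= F p v v)).
Proof.
have bound : (forall (p : M) (v : tangent p), is_null g v -> 0 <= F p v v) ->
    forall Z : set M, compact Z -> exists C : R, forall (p : M) (v : tangent p),
      Z p -> C * `|g p v v| <= F p v v.
  (* The bound with [- K] weakens as [K] grows, so it holds for [q] near [p] and all large [K];
     compactness then gives one [K] for all of [Z]. *)
  move=> Fnull Z /compact_near_coveringP cZ.
  have /cZ : forall p, Z p -> \forall q \near p & K \near +oo,
      forall v : tangent q, - K * `|g q v v| <= F q v v.
    move=> p _; have [K0 hK0] := local_bound p hg hF Fnull.
    exists ([set q | forall v : tangent q, - K0 * `|g q v v| <= F q v v],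
      [set K | K0 <= K]); first by split=> //=; exact/nbhs_pinfty_ge/num_real.
    move=> [q K] /= [h hK] v; apply: le_trans (h v).
    by rewrite ler_wpM2r// lerN2.
  by move=> /filter_ex[K hK]; exists (- K) => p v Zp; exact: hK.
have timelike (C : R) (p : M) (v : tangent p) :
    C * `|g p v v| <= F p v v -> is_timelike g v -> - C * g p v v <= F p v v.
  by move=> + gv; rewrite ltr0_norm// mulrN mulNr.
split; [split|].
- move=> Fnull Z /(bound Fnull)[C hC]; exists (- C) => p v Zp.
  exact: timelike (hC p v Zp).
(* Perturbing a null vector keeps its base point, so the compact set [{p}] suffices. *)
- move=> hZ p v; have [C hC] := hZ _ (@compact_set1 _ p).
  move=> gv; apply: (@nonneg_on_null_of_timelike _ _ (g p) (F p) C _ _ _ v gv).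
  - exact: (Defs.metric_sym hg).
  - exact: (metric_nondegenerate hg).
  - by move=> w; exact: hC.
- move=> Fnull Z cZ; split; first exact: bound.
  by move=> C hC p v Zp; exact: timelike (hC p v Zp).
Qed.
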